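(* Suppose there exist non-negative functions $\psi_{j,k}:\mathcal X\times\{1,\dots,n\}\to\mathbb R$, $j=1,\dots,p_k$, $k=1,\dots,r$ (with $\sum_{k=1}^r p_k=p$), and constants $\{c_{i,\theta}\}$ such that for all $\theta,\tilde\theta\in\Theta_*$ and all $i=1,\dots,n$, $$\bigl|[\rho_\theta(X_i)-c_{i,\theta}]-[\rho_{\tilde\theta}(X_i)-c_{i,\tilde\theta}]\bigr|\le\sum_{k=1}^r\Bigl|\sum_{j=1}^{p_k}(\theta_{j,k}-\tilde\theta_{j,k})\,\psi_{j,k}(X_i,i)\Bigr| .$$ Let $\xi_{1,k},\dots,\xi_{n,k}$, $k=1,\dots,r$, be independent $\mathcal N(0,1)$-distributed random variables, independent of $X_1,\dots,X_n$, and let $$X(\theta,\theta^* ):=\frac1n\sum_{i=1}^n\sum_{k=1}^r\sum_{j=1}^{p_k}(\theta_{j,k}-\theta^*_{j,k})\,\psi_{j,k}(X_i,i)\,\xi_{i,k}.$$ Then, for a universal constant $C$ (not depending on any other quantity), $$\mathbb E\Bigl(\sup_{\theta\in\Theta_M(\theta^* )}|Y^\varepsilon(\theta,\theta^* )|\,\Big|\,\mathbf X\Bigr)\le C\,2^{r-1}\,\mathbb E\Bigl(\sup_{\theta\in\Theta_M(\theta^* )}X(\theta,\theta^* )\,\Big|\,\mathbf X\Bigr).$$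
   Context: $X_1,\dots,X_n$ are independent random variables with values in a measurable space $\mathcal X$, and $\mathbf X:=(X_1,\dots,X_n)$. $\Theta\subset\mathbb R^p$ is a parameter space, and $\Theta_*$ is either $\Theta$ itself or the smallest convex set containing $\Theta$. For each $\theta\in\Theta_*$ a loss function $\rho_\theta:\mathcal X\to\mathbb R$ is given. Vectors in $\mathbb R^p$ are indexed as $\theta=(\theta_{j,k}:\ j=1,\dots,p_k,\ k=1,\dots,r)$, with $\sum_{k=1}^r p_k=p$, and $\|\theta\|_1$ is the $\ell_1$-norm. The $c_{i,\theta}$ ($i=1,\dots,n$, $\theta\in\Theta_*$) are non-random real constants, and $\rho^c_\theta(X_i,i):=\rho_\theta(X_i)-c_{i,\theta}$. $\theta^*\in\Theta$ is fixed, and for $M>0$, $$\Theta_M(\theta^* ):=\{\theta\in\Theta_*:\ \|\theta-\theta^*\|_1\le M\}.$$ $\varepsilon_1,\dots,\varepsilon_n$ is a Rademacher sequence (i.i.d., values $\pm1$ with probability $1/2$ each) independent of $\mathbf X$, and the symmetrized process is $$Y^\varepsilon(\theta,\theta^* ):=\frac1n\sum_{i=1}^n\varepsilon_i\bigl[\rho^c_\theta(X_i,i)-\rho^c_{\theta^*}(X_i,i)\bigr].$$ *)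

(* Defs.v *)
From HB Require Import structures.
From mathcomp Require Import all_boot all_order all_algebra.
From mathcomp Require Import all_classical all_reals all_analysis measurable_realfun.

Set Implicit Arguments.
Unset Strict Implicit.
Unset Printing Implicit Defensive.

Import Order.TTheory GRing.Theory Num.Theory.
Import numFieldNormedType.Exports.

Local Open Scope classical_set_scope.
Local Open Scope ring_scope.

(* The sub-sigma-algebra of T generated by a family of maps. *)
Definition sigma_family (I : Type) d d' (T : measurableType d)
    (S : measurableType d') (f : I -> T -> S) : set_system T :=
  <<s \bigcup_(i in [set: I]) preimage_set_system setT (f i) measurable >>.

Definition independent_systems d (T : measurableType d) (R : realType)
    (P : probability T R) (F G : set_system T) : Prop :=
  forall A B, F A -> G B -> P (A `&` B) = (P A * P B)%E.

Definition independent_family (I : finType) d d' (T : measurableType d)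
    (S : measurableType d') (R : realType) (P : probability T R)
    (f : I -> T -> S) : Prop :=
  forall (J : {set I}) (B : I -> set S),
    (forall i, i \in J -> measurable (B i)) ->
    P (\bigcap_(i in [set` J]) (f i @^-1` B i)) =
    (\prod_(i in J) P (f i @^-1` B i))%E.

(* g is a version of the conditional expectation of f given the
   sub-sigma-algebra F, for f >= 0 measurable; f need not be integrable, so
   that f and g take values in [0, +oo]. *)
Definition is_cond_expectation d (T : measurableType d) (R : realType)
    (P : probability T R) (F : set_system T) (f g : T -> \bar R) : Prop :=
  [/\ measurable_fun setT f /\ (forall w, (0 <= f w)%E),
      forall w, (0 <= g w)%E,
      forall B : set (\bar R), measurable B -> F (g @^-1` B) &
      forall A, F A -> (\int[P]_(w in A) g w = \int[P]_(w in A) f w)%E].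

(* The entry theta_{j,k} of a vector of R^p, p = \sum_k p_k. *)
Definition entry (R : realType) (r : nat) (p : 'I_r -> nat)
    (theta : 'rV[R]_(\sum_(k < r) p k)%N) (k : 'I_r) (j : 'I_(p k)) : R :=
  theta 0 (tagnat.Rank k j).

Definition l1norm (R : realType) (m : nat) (theta : 'rV[R]_m) : R :=
  \sum_(l < m) `|theta 0 l|.

Definition l1ball_in (R : realType) (m : nat) (Thetas : set 'rV[R]_m)
    (thetastar : 'rV[R]_m) (M : R) : set 'rV[R]_m :=
  [set theta | Thetas theta /\ l1norm (theta - thetastar) <= M].

Definition rho_c (R : realType) (n m : nat) (X : Type)
    (rho : 'rV[R]_m -> X -> R) (c : 'I_n -> 'rV[R]_m -> R)
    (theta : 'rV[R]_m) (x : X) (i : 'I_n) : R :=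
  rho theta x - c i theta.

Definition Y_eps (R : realType) (n m : nat) (T X : Type)
    (rho : 'rV[R]_m -> X -> R) (c : 'I_n -> 'rV[R]_m -> R)
    (Xs : 'I_n -> T -> X) (eps : 'I_n -> T -> R)
    (theta thetastar : 'rV[R]_m) (w : T) : R :=
  n%:R^-1 * \sum_(i < n) eps i w *
    (rho_c rho c theta (Xs i w) i - rho_c rho c thetastar (Xs i w) i).

Definition X_gauss (R : realType) (n r : nat) (p : 'I_r -> nat) (T X : Type)
    (psi : forall k : 'I_r, 'I_(p k) -> X -> 'I_n -> R)
    (Xs : 'I_n -> T -> X) (xi : 'I_n -> 'I_r -> T -> R)
    (theta thetastar : 'rV[R]_(\sum_(k < r) p k)%N) (w : T) : R :=
  n%:R^-1 * \sum_(i < n) \sum_(k < r) \sum_(j < p k)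
    (entry theta j - entry thetastar j) * psi k j (Xs i w) i * xi i k w.

Definition sup_over (R : realType) (V T : Type) (A : set V)
    (Z : V -> T -> R) (w : T) : \bar R :=
  ereal_sup [set (Z theta w)%:E | theta in A].

(* Main.v *)
Require Import Defs.
From HB Require Import structures.
From mathcomp Require Import all_boot all_order all_algebra.
From mathcomp Require Import all_classical all_reals all_analysis measurable_realfun.
From mathcomp Require Import ring lra.

(* By independence, both conditional expectations are obtained by freezing X
   and averaging over the signs, respectively over the Gaussian variables, so
   it is enough to compare the two averages for fixed X. The signs of the
   increments of Y are replaced one index i at a time:
     sup (G + F) + sup (G - F) = sup_(s,t) (G s + G t + F s - F t),
   where F s - F t is at most the l1-norm of the increment of the vector
   (v_k)_k of linear forms, hence at most 2^(r-1) times the average over random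
   signs of |sum_k +-(v_k s - v_k t)|; as signs are symmetric, the right-hand
   side decouples again. This bounds the average for Y by the one for the linear
   process with n r signs. Finally, conditionally on the sign pattern tau of
   xi, the expectation of |xi_ik| is 2 normal_peak 1 = E|xi|, so that
   E sup (sum xi v) >= E|xi| E_tau sup (sum tau v) by exchanging the supremum
   and the conditional expectation. *)

Set Implicit Arguments.
Unset Strict Implicit.
Unset Printing Implicit Defensive.

Import Order.TTheory GRing.Theory Num.Theory.
Import numFieldNormedType.Exports.

Local Open Scope classical_set_scope.
Local Open Scope ring_scope.

(** * Contraction for averages over signs *)

Section bounded_sup.
Context {R : realType} {T : Type}.
Implicit Types u v : T -> R.

Definition is_bounded u := exists K, forall t, `|u t| <= K.

(** [sup] is only meaningful on nonempty sets that are bounded above; hence the base point [t0] and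
    the predicate [is_bounded] below. *)
Definition supr u : R := sup (range u).

Lemma is_bounded0 : is_bounded (fun=> 0).
Proof. by exists 0 => t; rewrite normr0. Qed.

Lemma is_boundedD u v :
  is_bounded u -> is_bounded v -> is_bounded (fun t => u t + v t).
Proof.
move=> [K hK] [L hL]; exists (K + L) => t.
by rewrite (le_trans (ler_normD _ _))// lerD.
Qed.

Lemma is_boundedZ a u : is_bounded u -> is_bounded (fun t => a * u t).
Proof. by move=> [K hK]; exists (`|a| * K) => t; rewrite normrM ler_wpM2l. Qed.

Lemma is_boundedN u : is_bounded u -> is_bounded (fun t => - u t).
Proof. by move=> [K hK]; exists K => t; rewrite normrN. Qed.

Lemma is_bounded_norm u : is_bounded u -> is_bounded (fun t => `|u t|).
Proof. by move=> [K hK]; exists K => t; rewrite normr_id. Qed.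

Lemma is_bounded_sum (I : Type) (s : seq I) (u : I -> T -> R) :
  (forall i, is_bounded (u i)) -> is_bounded (fun t => \sum_(i <- s) u i t).
Proof.
move=> hu; elim: s => [|i s IH].
  by under eq_fun do rewrite big_nil; exact: is_bounded0.
by under eq_fun do rewrite big_cons; exact: is_boundedD.
Qed.

Lemma supr_ub u t : is_bounded u -> u t <= supr u.
Proof.
move=> [K hK]; apply: ub_le_sup; last by exists t.
by exists K => _ [s _ <-]; rewrite (le_trans (ler_norm _)).
Qed.

Lemma supr_le (t0 : T) u c : (forall t, u t <= c) -> supr u <= c.
Proof.
by move=> uc; apply: ge_sup; [exists (u t0), t0|move=> _ [t _ <-]].
Qed.

(** A sum of suprema is a supremum over pairs [(s, t)]; this second copy of the index is what makes
    increments [F s - F t] appear. *)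
Lemma suprD_le (t0 : T) u v c :
  (forall s t, u s + v t <= c) -> supr u + supr v <= c.
Proof.
move=> uvc; rewrite -lerBrDr; apply: (supr_le t0) => s.
by rewrite lerBrDr addrC -lerBrDr; apply: (supr_le t0) => t; rewrite lerBrDl.
Qed.

Lemma suprZ (t0 : T) a u : is_bounded u -> 0 <= a ->
  supr (fun t => a * u t) = a * supr u.
Proof.
move=> bu; rewrite le_eqVlt => /predU1P[<-|a0].
  rewrite mul0r; apply/eqP; rewrite eq_le; apply/andP; split.
    by apply: (supr_le t0) => t; rewrite mul0r.
  apply: le_trans (supr_ub t0 _); first by rewrite mul0r.
  exact: is_boundedZ.
apply/eqP; rewrite eq_le; apply/andP; split.
  by apply: (supr_le t0) => t; rewrite ler_pM2l// supr_ub.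
rewrite -ler_pdivlMl//; apply: (supr_le t0) => t.
by rewrite ler_pdivlMl// (supr_ub t (is_boundedZ a bu)).
Qed.

End bounded_sup.

Section sign_sums.
Context {R : realType}.

Lemma signed_sum_ge_norm (r : nat) (a : 'I_r -> R) : (0 < r)%N ->
  (\sum_k `|a k|) *+ 2 <=
  \sum_(s : {ffun 'I_r -> bool}) `|\sum_k (-1) ^+ s k * a k|.
Proof.
move=> r0.
(* The sign pattern of [a] and its opposite each contribute the l1-norm of [a]. *)
pose s1 : {ffun 'I_r -> bool} := [ffun k => a k < 0].
pose s2 : {ffun 'I_r -> bool} := [ffun k => ~~ (a k < 0)].
have s12 : s2 != s1.
  by apply/eqP => /ffunP/(_ (Ordinal r0)); rewrite !ffunE; case: (_ < _).
have e1 : \sum_k (-1) ^+ s1 k * a k = \sum_k `|a k|.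
  apply: eq_bigr => k _; rewrite ffunE.
  by rewrite mulr_sign; case: ltP => h; rewrite ?(ltr0_norm h) ?(ger0_norm h).
have e2 : \sum_k (-1) ^+ s2 k * a k = - \sum_k `|a k|.
  rewrite -sumrN; apply: eq_bigr => k _; rewrite ffunE.
  by rewrite mulr_sign; case: ltP => h; rewrite ?(ltr0_norm h) ?(ger0_norm h) ?opprK.
rewrite (bigD1 s1)//= (bigD1 s2)//= e1 e2 normrN ger0_norm ?sumr_ge0//.
by rewrite addrA mulr2n lerDl sumr_ge0.
Qed.

(** Functions on [n.+1] indices correspond to pairs of a value at [ord0] and a function on the
    remaining indices. This peels off one index in the induction on [n]. *)
Lemma sum_ffun_recl (n : nat) (B : finType) (f : {ffun 'I_n.+1 -> B} -> R) :
  \sum_(e : {ffun 'I_n.+1 -> B}) f e =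
  \sum_(b : B) \sum_(e : {ffun 'I_n -> B})
    f [ffun i => if unlift ord0 i is Some j then e j else b].
Proof.
rewrite pair_big/=.
pose h (x : B * {ffun 'I_n -> B}) : {ffun 'I_n.+1 -> B} :=
  [ffun i => if unlift ord0 i is Some j then x.2 j else x.1].
pose g (e : {ffun 'I_n.+1 -> B}) : B * {ffun 'I_n -> B} :=
  (e ord0, [ffun j => e (lift ord0 j)]).
rewrite (reindex h)//; exists g => [[b e] _|e _].
  rewrite /g /h; congr pair; first by rewrite ffunE unlift_none.
  by apply/ffunP => j; rewrite !ffunE liftK.
by apply/ffunP => i; rewrite ffunE; case: unliftP => [j ->|->]; rewrite ?ffunE.
Qed.

End sign_sums.

Section contraction.
Context {R : realType} {T : Type} (t0 : T) {Gam : finType} (neg : Gam -> Gam).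
Hypothesis negK : involutive neg.

(** [Gam] stands for the sign vectors that replace a single sign, and [neg] for the global change of
    sign. By this symmetry the right-hand side is the sum over [g] of sup (G + w g) + sup (G - w g).
    Cardinals multiply the two sides crosswise to avoid fractions. *)
Lemma sign_contraction1 (F G : T -> R) (w : Gam -> T -> R) :
  is_bounded F -> is_bounded G -> (forall g, is_bounded (w g)) ->
  (forall g t, w (neg g) t = - w g t) ->
  (forall s t, `|F s - F t| *+ #|Gam| <= \sum_g `|w g s - w g t|) ->
  (supr (fun t => G t + F t) + supr (fun t => G t - F t)) *+ #|Gam| <=
  (\sum_g supr (fun t => G t + w g t)) *+ 2.
Proof.
move=> bF bG bw wN lip.
have sumN : \sum_g supr (fun t => G t - w g t) = \sum_g supr (fun t => G t + w g t).
  rewrite (reindex_inj (inv_inj negK)); apply: eq_bigr => g _.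
  by congr supr; apply/funext => t; rewrite wN opprK.
rewrite mulr2n -[X in _ <= X + _]sumN -big_split/= mulrnDl.
(* For empty [Gam] both sides vanish; otherwise division by its cardinal is allowed. *)
case: (posnP #|Gam|) => [c0|cgt0].
  rewrite c0 !mulr0n addr0 big_pred0// => g; apply/negbTE.
  by have := card0_eq c0 g; rewrite inE => ->.
rewrite -mulrnDl -mulr_natr -ler_pdivlMr ?ltr0n//; apply: (suprD_le t0) => s t /=.
rewrite ler_pdivlMr ?ltr0n// mulr_natr.
apply: (@le_trans _ _ (\sum_g (G s + G t + `|w g s - w g t|))).
  rewrite big_split/= sumr_const -[#|_|]/#|Gam|.
  apply: (@le_trans _ _ ((G s + G t + `|F s - F t|) *+ #|Gam|)).
    rewrite lerMn2r; apply/orP; right.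
    by have := ler_norm (F s - F t); lra.
  by rewrite mulrnDl lerD2l.
apply: ler_sum => g _.
have bp : is_bounded (fun t => G t + w g t) by exact: is_boundedD.
have bm : is_bounded (fun t => G t - w g t).
  by apply: is_boundedD => //; exact: is_boundedN.
have /= h1 := supr_ub s bp; have /= h2 := supr_ub t bp.
have /= h3 := supr_ub s bm; have /= h4 := supr_ub t bm.
move: h1 h2 h3 h4; set A := supr _; set B := supr _ => h1 h2 h3 h4.
(* The sign of the increment decides which of [s] and [t] goes into sup (G + w g) and which into sup
   (G - w g). *)
by case: (ger0P (w g s - w g t)) => h5; lra.
Qed.

(** Induction on [n] with [G] arbitrary, since [G] collects the terms kept fixed: first the signed
    [F ord0] while the other indices are replaced, then the replaced terms while [ord0] is
    treated. *)
Lemma sign_contraction (n : nat) (F : 'I_n -> T -> R) (w : 'I_n -> Gam -> T -> R)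
    (G : T -> R) :
  (forall i, is_bounded (F i)) -> is_bounded G ->
  (forall i g, is_bounded (w i g)) ->
  (forall i g t, w i (neg g) t = - w i g t) ->
  (forall i s t, `|F i s - F i t| *+ #|Gam| <= \sum_g `|w i g s - w i g t|) ->
  (\sum_(e : {ffun 'I_n -> bool})
     supr (fun t => G t + \sum_i (-1) ^+ e i * F i t)) *+ (#|Gam| ^ n) <=
  (\sum_(e : {ffun 'I_n -> Gam})
     supr (fun t => G t + \sum_i w i (e i) t)) *+ (2 ^ n).
Proof.
elim: n F w G => [|n IH] F w G bF bG bw wN lip.
  rewrite !expn0 !mulr1n.
  under eq_bigr do under eq_fun do rewrite big_ord0 addr0.
  under [leRHS]eq_bigr do under eq_fun do rewrite big_ord0 addr0.
  by rewrite !sumr_const !cardT -!cardE !card_ffun !card_ord !expn0.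
rewrite !sum_ffun_recl !expnSr !mulrnA.
pose F' (i : 'I_n) := F (lift ord0 i); pose w' (i : 'I_n) := w (lift ord0 i).
(* The intermediate sum has a sign at [ord0] and elements of [Gam] at all other indices. *)
pose Y := \sum_(b : bool) \sum_(e : {ffun 'I_n -> Gam})
  supr (fun t => (G t + (-1) ^+ b * F ord0 t) + \sum_i w' i (e i) t).
have bFb (b : bool) : is_bounded (fun t => G t + (-1) ^+ b * F ord0 t).
  by apply: is_boundedD => //; exact: is_boundedZ.
apply: (@le_trans _ _ (Y *+ (2 ^ n) *+ #|Gam|)).
  rewrite lerMn2r; apply/orP; right; rewrite -!sumrMnl; apply: ler_sum => b _.
  apply: le_trans (IH F' w' _ _ (bFb b) _ _ _); last 4 first.
  - by move=> i; exact: bF.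
  - by move=> i g; exact: bw.
  - by move=> i g t; exact: wN.
  - by move=> i s t; exact: lip.
  rewrite le_eqVlt; apply/orP; left; apply/eqP; congr (_ *+ _).
  apply: eq_bigr => e _; congr supr; apply/funext => t.
  rewrite big_ord_recl ffunE unlift_none addrA; congr (_ + _).
  by apply: eq_bigr => i _; rewrite ffunE liftK.
rewrite -[leLHS]mulrnA mulnC mulrnA -[leRHS]mulrnA mulnC mulrnA.
rewrite lerMn2r; apply/orP; right.
rewrite /Y exchange_big [in leRHS]exchange_big -!sumrMnl.
apply: ler_sum => e _.
have bG' : is_bounded (fun t => G t + \sum_i w' i (e i) t).
  by apply: is_boundedD => //; apply: is_bounded_sum => i; exact: bw.
have := sign_contraction1 (bF ord0) bG' (bw ord0) (wN ord0) (lip ord0).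
rewrite big_bool [in X in X -> _]addrC.
congr (_ *+ _ <= _ *+ _).
  congr (_ + _); congr supr; apply/funext => t.
  - by rewrite mulr_sign addrAC.
  - by rewrite mulr_sign addrAC.
apply: eq_bigr => g _; congr supr; apply/funext => t.
rewrite big_ord_recl ffunE unlift_none addrAC -addrA; congr (_ + (_ + _)).
by apply: eq_bigr => i _; rewrite ffunE liftK.
Qed.

End contraction.

(** [Gam] is the set of sign vectors of length [r]. Two of these 2^r vectors attain the l1-norm, so
    the average of |sum_k +-a_k| is at least 2^(1-r) times that norm; the factor 2^(r-1) in [w]
    compensates for this. *)
Lemma vector_contraction {R : realType} {T : Type} (t0 : T) (n r : nat)
    (F : 'I_n -> T -> R) (v : 'I_n -> 'I_r -> T -> R) :
  (0 < r)%N -> (forall i, is_bounded (F i)) ->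
  (forall i k, is_bounded (v i k)) ->
  (forall i s t, `|F i s - F i t| <= \sum_k `|v i k s - v i k t|) ->
  2 ^- n * \sum_(e : {ffun 'I_n -> bool})
    supr (fun t => \sum_i (-1) ^+ e i * F i t) <=
  2 ^+ (r - 1) * (2 ^- (n * r) *
  \sum_(e : {ffun 'I_n -> {ffun 'I_r -> bool}})
    supr (fun t => \sum_i \sum_k (-1) ^+ e i k * v i k t)).
Proof.
move=> r0 bF bv lip.
pose neg (g : {ffun 'I_r -> bool}) : {ffun 'I_r -> bool} := [ffun k => ~~ g k].
have negK : involutive neg.
  by move=> g; apply/ffunP => k; rewrite !ffunE negbK.
pose w i (g : {ffun 'I_r -> bool}) t : R :=
  2 ^+ (r - 1) * \sum_k (-1) ^+ g k * v i k t.
have cardG : #|{ffun 'I_r -> bool}| = (2 ^ r)%N.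
  by rewrite card_ffun card_bool card_ord.
have bw i g : is_bounded (w i g).
  by apply: is_boundedZ; apply: is_bounded_sum => k; exact: is_boundedZ.
have wN i g t : w i (neg g) t = - w i g t.
  rewrite /w -mulrN -sumrN; congr (_ * _); apply: eq_bigr => k _.
  by rewrite ffunE signrN mulNr.
have wlip i s t :
    `|F i s - F i t| *+ #|{ffun 'I_r -> bool}| <= \sum_g `|w i g s - w i g t|.
  rewrite cardG.
  apply: (@le_trans _ _ ((\sum_k `|v i k s - v i k t|) *+ (2 ^ r))).
    by rewrite lerMn2r lip orbT.
  have -> : \sum_g `|w i g s - w i g t| = (\sum_(g : {ffun 'I_r -> bool})
      `|\sum_k (-1) ^+ g k * (v i k s - v i k t)|) *+ (2 ^ (r - 1)).
    rewrite -sumrMnl; apply: eq_bigr => g _.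
    rewrite /w -mulrBr normrM ger0_norm ?exprn_ge0// -natrX mulr_natl.
    rewrite -sumrB; congr (`|_| *+ _); apply: eq_bigr => k _.
    by rewrite mulrBr.
  have -> : (2 ^ r = 2 * 2 ^ (r - 1))%N by rewrite -expnS subn1 prednK.
  rewrite mulrnA lerMn2r; apply/orP; right.
  exact: signed_sum_ge_norm.
have h := sign_contraction t0 negK bF is_bounded0 bw wN wlip; move: h.
have -> : \sum_(e : {ffun 'I_n -> {ffun 'I_r -> bool}})
    supr (fun t => 0 + \sum_i w i (e i) t) = 2 ^+ (r - 1) *
    \sum_(e : {ffun 'I_n -> {ffun 'I_r -> bool}})
      supr (fun t => \sum_i \sum_k (-1) ^+ e i k * v i k t).
  rewrite mulr_sumr; apply: eq_bigr => e _.
  rewrite -(suprZ t0) ?exprn_ge0//.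
    by congr supr; apply/funext => t; rewrite add0r /w mulr_sumr.
  by apply: is_bounded_sum => i; apply: is_bounded_sum => k; exact: is_boundedZ.
under eq_bigr do under eq_fun do rewrite add0r.
rewrite cardG -expnM => h.
have {}h : (\sum_(e : {ffun 'I_n -> bool})
    supr (fun t => \sum_i (-1) ^+ e i * F i t)) * 2 ^+ (r * n) <=
  2 ^+ (r - 1) * (\sum_(e : {ffun 'I_n -> {ffun 'I_r -> bool}})
      supr (fun t => \sum_i \sum_k (-1) ^+ e i k * v i k t)) * 2 ^+ n.
  by rewrite -[2 ^+ (r * n)]natrX -[2 ^+ n]natrX !mulr_natr.
rewrite (mulnC n) mulrCA (mulrC (2 ^- n)) ler_pdivrMr ?exprn_gt0// -mulrA.
by rewrite ler_pdivlMl ?exprn_gt0// mulrC.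
Qed.

(** Both suprema on the right are nonnegative because [u] vanishes at [t0], so either may be added
    to a bound given by the other. *)
Lemma supr_norm_le {R : realType} {T : Type} (t0 : T) (u : T -> R) :
  is_bounded u -> u t0 = 0 ->
  supr (fun t => `|u t|) <= supr u + supr (fun t => - u t).
Proof.
move=> bu u0; apply: (supr_le t0) => t.
have /= h1 := supr_ub t bu; have /= h2 := supr_ub t (is_boundedN bu).
have /= := supr_ub t0 bu; have /= := supr_ub t0 (is_boundedN bu).
rewrite u0 oppr0 => h3 h4; rewrite ler_norml; apply/andP; split; lra.
Qed.

(** The absolute value costs a factor 2: the contraction is applied to [F] and to [- F], which have
    the same Lipschitz bound. The signs are re-indexed by pairs [(i, k)], as the Gaussian variables
    are. *)
Lemma vector_contraction_norm {R : realType} {T : Type} (t0 : T) (n r : nat)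
    (F : 'I_n -> T -> R) (v : 'I_n -> 'I_r -> T -> R) :
  (0 < r)%N -> (forall i, is_bounded (F i)) ->
  (forall i k, is_bounded (v i k)) -> (forall i, F i t0 = 0) ->
  (forall i s t, `|F i s - F i t| <= \sum_k `|v i k s - v i k t|) ->
  2 ^- n * \sum_(e : {ffun 'I_n -> bool})
    supr (fun t => `|\sum_i (-1) ^+ e i * F i t|) <=
  2 ^+ (r - 1) * (2 * (2 ^- (n * r) *
  \sum_(e : {ffun 'I_n * 'I_r -> bool})
    supr (fun t => \sum_ik (-1) ^+ e ik * v ik.1 ik.2 t))).
Proof.
move=> r0 bF bv F0 lip.
have -> : \sum_(e : {ffun 'I_n * 'I_r -> bool})
    supr (fun t => \sum_ik (-1) ^+ e ik * v ik.1 ik.2 t) =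
  \sum_(e : {ffun 'I_n -> {ffun 'I_r -> bool}})
    supr (fun t => \sum_i \sum_k (-1) ^+ e i k * v i k t).
  pose h (e : {ffun 'I_n -> {ffun 'I_r -> bool}}) : {ffun 'I_n * 'I_r -> bool} :=
    [ffun ik => e ik.1 ik.2].
  pose h' (e : {ffun 'I_n * 'I_r -> bool}) : {ffun 'I_n -> {ffun 'I_r -> bool}} :=
    [ffun i => [ffun k => e (i, k)]].
  rewrite (reindex h); last first.
    exists h' => e _; first by do 2 (apply/ffunP => ?; rewrite !ffunE).
    by apply/ffunP => -[i k]; rewrite !ffunE.
  apply: eq_bigr => e _; congr supr; apply/funext => t.
  by rewrite pair_big/=; apply: eq_bigr => -[i k] _; rewrite ffunE.
have c1 := vector_contraction t0 r0 bF bv lip.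
have bN i : is_bounded (fun t => - F i t) by exact: is_boundedN.
have lipN i s t : `|- F i s - - F i t| <= \sum_k `|v i k s - v i k t|.
  by rewrite -opprD normrN lip.
have c2 := vector_contraction t0 r0 bN bv lipN.
rewrite [2 * _]mulr_natl mulr2n mulrDr; apply: le_trans (lerD c1 c2).
rewrite -mulrDr ler_pM2l ?invr_gt0 ?exprn_gt0// -big_split/=.
apply: ler_sum => e _.
have -> : supr (fun t => \sum_i (-1) ^+ e i * - F i t) =
    supr (fun t => - \sum_i (-1) ^+ e i * F i t).
  congr supr; apply/funext => t; rewrite -sumrN.
  by apply: eq_bigr => i _; rewrite mulrN.
apply: (supr_norm_le (t0 := t0)).
  by apply: is_bounded_sum => i; exact: is_boundedZ.
by rewrite big1// => i _; rewrite F0 mulr0.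
Qed.

(** * Half-line moments of the normal law *)

Section normal.
Context {R : realType}.
Local Notation mu := (@lebesgue_measure R).
Local Notation pdf := (@normal_pdf R 0 1).

(** Change of variables with the Radon-Nikodym derivative, which agrees almost everywhere with
    [normal_pdf] because both have the same integrals. *)
Lemma ge0_integral_normal_prob (m s : R) (f : R -> \bar R) (E : set R) :
  measurable E -> measurable_fun E f -> (forall x, (0 <= f x)%E) ->
  (\int[normal_prob m s]_(x in E) f x =
   \int[mu]_(x in E) (f x * (normal_pdf m s x)%:E))%E.
Proof.
move=> mE mf f0; have dom := normal_prob_dominates m s.
rewrite -(Radon_Nikodym_SigmaFinite.change_of_variables dom)//.
have mRN := measurable_int _ (Radon_Nikodym_SigmaFinite.f_integrable dom).
apply: ae_eq_integral => //.
- by apply: emeasurable_funM => //; exact: measurable_funTS.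
- apply: emeasurable_funM => //; apply/measurable_funTS/measurable_EFinP.
  exact: measurable_normal_pdf.
- apply: ae_eqe_mul2l; apply: integral_ae_eq => //.
  + apply: (integrableS measurableT) => //.
    exact: Radon_Nikodym_SigmaFinite.f_integrable.
  + by apply/measurable_funTS/measurable_EFinP; exact: measurable_normal_pdf.
  + by move=> A AE mA; rewrite -Radon_Nikodym_SigmaFinite.f_integral.
Qed.

(* [false] stands for the positive half-line, matching [(-1) ^+ b]. *)
Definition halfline (b : bool) : set R := [set x | 0 < (-1) ^+ b * x].

Lemma halflineE b : halfline b = if b then `]-oo, 0[%classic else `]0, +oo[%classic.
Proof.
by apply/seteqP; split => x; rewrite /halfline [X in X -> _]/= [X in _ -> X]/=
  mulr_sign; case: b; rewrite /= ?in_itv/= ?andbT ?oppr_gt0.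
Qed.

Lemma measurable_halfline b : measurable (halfline b).
Proof. by rewrite halflineE; case: b; exact: measurable_itv. Qed.

Lemma normal_pdf01E (x : R) : pdf x = normal_peak 1 * expR (- x ^+ 2 / 2).
Proof.
by rewrite normal_pdfE ?oner_neq0// /normal_fun subr0 expr1n.
Qed.

(** For even [f] the substitution of -x for x exchanges the half-lines, and the end point 0 is
    negligible. *)
Lemma integral_halfline (f : R -> R) b : continuous f -> (forall x, 0 <= f x) ->
  f \o -%R =1 f ->
  (\int[mu]_(x in halfline b) (f x)%:E = \int[mu]_(x in `[0%R, +oo[) (f x)%:E)%E.
Proof.
move=> cf f0 fN.
have mf : measurable_fun [set: R] f by exact: continuous_measurable_fun.
rewrite halflineE; case: b; last first.
  by rewrite integral_itv_obnd_cbnd//; exact/measurable_EFinP/measurable_funTS.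
rewrite integral_itv_bndo_bndc//; last exact/measurable_EFinP/measurable_funTS.
rewrite -{1}oppr0 ge0_integration_by_substitutionNy//.
- by apply: eq_integral => x _; rewrite fN.
- exact: continuous_subspaceT.
Qed.

Lemma normal_prob_halfline b : normal_prob 0 1 (halfline b) = (2^-1)%:E :> \bar R.
Proof.
have pN : pdf \o -%R =1 pdf by move=> x /=; rewrite !normal_pdf01E sqrrN.
have cp : continuous pdf by apply: continuous_normal_pdf; exact: oner_neq0.
have p0 x : 0 <= pdf x by exact: normal_pdf_ge0.
rewrite /normal_prob integral_halfline//.
have := integral_normal_pdf (0 : R) 1.
rewrite ge0_symfun_integralT// -set_itvcy.
(* Twice the half-line integral equals 1, which also rules out infinite values. *)
case: (\int[mu]_(x in _) _)%E => [x| |]//=.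
  by rewrite -EFinM => -[h]; congr EFin; lra.
- by rewrite mulry gtr0_sg// mul1e.
- by rewrite mulrNy gtr0_sg// mul1e.
Qed.

Lemma normal_prob_abs_halfline b :
  (\int[normal_prob 0 1]_(x in halfline b) `|x|%:E = (normal_peak 1 : R)%:E)%E.
Proof.
have cp : continuous pdf by apply: continuous_normal_pdf; exact: oner_neq0.
have mabs : measurable_fun (halfline b) (fun x : R => `|x|%:E).
  by apply/measurable_EFinP; apply: measurable_funTS; exact: normr_measurable.
rewrite ge0_integral_normal_prob//; last exact: measurable_halfline.
under eq_integral do rewrite -EFinM.
rewrite (integral_halfline b (f := fun x => `|x| * pdf x)); last 3 first.
- by move=> x; apply: cvgM; [exact: norm_continuous|exact: cp].
- by move=> x; rewrite mulr_ge0// normal_pdf_ge0.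
- by move=> x /=; rewrite !normal_pdf01E sqrrN normrN.
(* On the positive half-line the integrand has the antiderivative [- pdf], so the integral is
   [pdf 0], that is [normal_peak 1]. *)
have dF (x : R) : is_derive x 1 (fun x => - pdf x) (x * pdf x).
  pose g : R -> R := - (2^-1 \*: (@id R ^+ 2)).
  have dg : is_derive x 1 g (- x).
    rewrite /g; apply: is_derive_eq.
    by rewrite expr1 scaler1 /GRing.scale/= mulrA mulVf ?mul1r// pnatr_eq0.
  have -> : (fun x => - pdf x) = - (normal_peak 1 \*: (expR \o g)).
    apply/funext => y; rewrite normal_pdf01E /g !fctE/=; congr (- (_ * expR _)).
    by rewrite /GRing.scale/= mulNr mulrC.
  have dc := is_derive1_comp (is_derive_expR (g x)) dg.
  apply: is_derive_eq; rewrite normal_pdf01E /GRing.scale/=.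
  have -> : g x = - x ^+ 2 / 2 by rewrite /g !fctE/= /GRing.scale/= mulNr mulrC.
  by rewrite mulrN mulrN opprK mulrA mulrC.
rewrite (@ge0_continuous_FTC2y R _ (fun x => - pdf x) 0 0).
- rewrite -EFinB; congr EFin.
  by rewrite normal_pdf01E expr0n/= oppr0 mul0r expR0 mulr1 opprK add0r.
- by move=> x x0; rewrite mulr_ge0// normal_pdf_ge0.
- apply: continuous_subspaceT => x.
  by apply: cvgM; [exact: norm_continuous|exact: cp].
- have -> : (fun x => - pdf x) =
      (fun x => - normal_peak 1 * expR (- (x ^+ 2 * 2^-1))).
    by apply/funext => x; rewrite normal_pdf01E mulNr [in RHS]mulNr.
  rewrite -(mulr0 (- normal_peak 1)); apply: cvgM; first exact: cvg_cst.
  apply: (cvg_comp (fun x => x ^+ 2 * 2^-1) (fun x => expR (- x))).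
    by apply: gt0_cvgMly; [rewrite invr_gt0|exact: cvgr_expr2].
  exact: cvgr_expR.
- by move=> x x0.
- apply: cvg_at_right_filter; apply: cvgN; exact: cp.
- move=> x; rewrite in_itv/= andbT => x0; rewrite derive1E derive_val.
  by rewrite ger0_norm// ltW.
Qed.
End normal.

(** * Rademacher and Gaussian averages *)

Lemma measurable_preimage d d' (T : measurableType d) (T' : measurableType d')
    (f : T -> T') (A : set T') :
  measurable_fun setT f -> measurable A -> measurable (f @^-1` A).
Proof. by move=> mf mA; rewrite -[_ @^-1` _]setTI; exact: mf. Qed.

Section integral_mrestr.
Context d (T : measurableType d) (R : realType).
Variable (mu : {measure set T -> \bar R}).
Local Open Scope ereal_scope.

(** The complement of [B] is negligible for the restriction, and both measures agree on the subsets
    of [B]. *)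
Lemma ge0_integral_mrestr (B E : set T) (mB : measurable B) (f : T -> \bar R) :
  measurable E -> measurable_fun E f -> (forall x, E x -> 0 <= f x) ->
  \int[mrestr mu mB]_(x in E) f x = \int[mu]_(x in E `&` B) f x.
Proof.
move=> mE mf f0.
rewrite (@ge0_negligible_integral _ _ _ _ E (~` B))//; first last.
- by rewrite /= /mrestr setICl measure0.
- exact: measurableC.
rewrite setDE setCK; apply: eq_measure_integral => A mA AEB.
by rewrite /= /mrestr (setIidl (subset_trans AEB (@subIsetr _ _ _))).
Qed.

End integral_mrestr.

Section indep_event.
Context d (T : measurableType d) (R : realType) (P : probability T R).
Context d' (S : measurableType d').
Local Open Scope ereal_scope.

(** The image under [g] of the restriction of [P] to [B] is [P B] times [Q], so this is a change of
    variables. *)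
Lemma integral_indep_event (B : set T) (g : T -> S)
    (Q : {measure set S -> \bar R}) (E : set S) (f : S -> \bar R) :
  measurable_fun setT g -> measurable B -> measurable E ->
  measurable_fun E f -> (forall x, E x -> 0 <= f x) ->
  (forall A, measurable A -> P (B `&` g @^-1` A) = P B * Q A) ->
  \int[P]_(x in B `&` g @^-1` E) f (g x) = P B * \int[Q]_(x in E) f x.
Proof.
move=> mg mB mE mf f0 BQ.
rewrite setIC -(@ge0_integral_mrestr _ _ _ P _ _ mB (f \o g)); first last.
- by move=> x; exact: f0.
- apply: (@measurable_comp _ _ _ _ _ _ E) => //; first by move=> _ [x ? <-].
  exact: measurable_funTS.
- exact: measurable_preimage.
rewrite -(@ge0_integral_pushforward _ _ _ _ _ _ mg (mrestr P mB))//; last first.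
  by move=> x /set_mem; exact: f0.
have PB0 : (0 <= fine (P B))%R by exact: fine_ge0.
pose k := NngNum PB0.
have -> : P B = (k%:num)%:E by rewrite /= fineK// fin_num_measure.
rewrite -ge0_integral_mscale//; apply: eq_measure_integral => A mA _.
change (P (g @^-1` A `&` B) = (fine (P B))%:E * Q A).
by rewrite setIC BQ// fineK// fin_num_measure.
Qed.

End indep_event.

Section sign_patterns.
Context d (T : measurableType d) (R : realType) (P : probability T R).
Context (I : finType) (g : I -> {RV P >-> R}) (S : bool -> set R).
Hypothesis g_indep : independent_family P g.
Hypothesis mS : forall b, measurable (S b).
Hypothesis S_disj : forall x, S true x -> S false x -> False.
Hypothesis g_half : forall i b, P (g i @^-1` S b) = (2^-1)%:E.
Local Open Scope ereal_scope.

(** [S] will be the points 1 and -1, or the two open half-lines. Constraining all indices gives a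
    partition up to a null set; constraining all but one gives an event independent of the remaining
    variable. *)
Definition sign_event (J : {set I}) (e : {ffun I -> bool}) : set T :=
  \bigcap_(i in [set` J]) (g i @^-1` S (e i)).

Lemma measurable_sign_event J e : measurable (sign_event J e).
Proof.
apply: fin_bigcap_measurable => [|i _]; first exact: finite_finset.
by apply: measurable_preimage => //; exact: measurable_funPT.
Qed.

Lemma sign_event_prob J e : P (sign_event J e) = (2 ^- #|J|)%:E.
Proof.
rewrite /sign_event (g_indep (B := fun i => S (e i)))//.
under eq_bigr do rewrite g_half.
by rewrite prodEFin prodr_const exprVn.
Qed.

(** The events are disjoint and each has mass 2^-|I|, so their union has full measure even if
    [S true] and [S false] do not cover the line. *)
Lemma integral_sign_events (W : T -> \bar R) : measurable_fun setT W ->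
  (forall w, 0 <= W w) ->
  \int[P]_w W w =
  \sum_(e : {ffun I -> bool}) \int[P]_(w in sign_event [set: I] e) W w.
Proof.
move=> mW W0.
pose D e := sign_event [set: I] e.
have tD : trivIset [set` enum {ffun I -> bool}] D.
  move=> e e' _ _ [w [we we']]; apply/ffunP => i.
  have := we i; have := we' i; rewrite /= !inE => /(_ isT) + /(_ isT).
  by case: (e i) (e' i) => -[] //= h h'; exfalso; apply: (@S_disj (g i w)).
pose U := \big[setU/set0]_(e <- enum {ffun I -> bool}) D e.
have mU : measurable U.
  by apply: bigsetU_measurable => e _; exact: measurable_sign_event.
have sumU (f : T -> \bar R) : measurable_fun setT f -> (forall w, 0 <= f w) ->
    \int[P]_(w in U) f w = \sum_e \int[P]_(w in D e) f w.
  move=> mf f0; rewrite /U ge0_integral_bigsetU//.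
  - by rewrite big_enum.
  - by move=> e; exact: measurable_sign_event.
  - exact: enum_uniq.
  - exact: measurable_funTS.
have PU : P U = 1.
  rewrite -[P U]mul1e -integral_cst// sumU//.
  rewrite (eq_bigr (fun=> (2 ^- #|I|)%:E)) => [|e _].
    rewrite sumEFin sumr_const card_ffun card_bool.
    by rewrite -[X in X%:E]mulr_natr natrX mulVf ?expf_neq0 ?pnatr_eq0.
  rewrite integral_cst ?mul1e; last exact: measurable_sign_event.
  by rewrite -cardsT; exact: sign_event_prob.
rewrite -(@sumU W)// (@ge0_negligible_integral _ _ _ _ _ (~` U))//.
- by rewrite setDE setCK setTI.
- exact: measurableC.
- by rewrite [LHS](probability_setC P mU) PU subee.
Qed.

End sign_patterns.

Lemma EFin_supr_le {R : realType} {T : Type} (t0 : T) (u : T -> R) (x : \bar R) :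
  (forall t, ((u t)%:E <= x)%E) -> ((supr u)%:E <= x)%E.
Proof.
case: x => [x| |] h; last by have := h t0.
  by rewrite lee_fin; apply: (supr_le t0) => t; rewrite -lee_fin.
exact: leey.
Qed.

Section rademacher_gauss.
Context d (Omega : measurableType d) (R : realType) (P : probability Omega R).
Context (I : finType) {T : Type} (t0 : T).

(** On each event of the partition the signs are constant, so [W] is bounded there by a constant. *)
Lemma rademacher_average_le (eps : I -> {RV P >-> R}) (F : I -> T -> R)
    (W : Omega -> \bar R) :
  independent_family P eps ->
  (forall i, P (eps i @^-1` [set 1]) = (2^-1)%:E /\
             P (eps i @^-1` [set -1]) = (2^-1)%:E) ->
  (forall i, is_bounded (F i)) ->
  measurable_fun setT W -> (forall w, (0 <= W w)%E) ->
  (forall w, (W w <= (supr (fun t => `|\sum_i eps i w * F i t|))%:E)%E) ->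
  (\int[P]_w W w <= (2 ^- #|I| * \sum_(e : {ffun I -> bool})
     supr (fun t => `|\sum_i (-1) ^+ e i * F i t|))%:E)%E.
Proof.
move=> eps_indep eps2 bF mW W0 Wle.
pose S (b : bool) : set R := [set (-1) ^+ b].
have mS b : measurable (S b) by exact: measurable_set1.
have SD x : S true x -> S false x -> False.
  rewrite /S/= expr1 expr0 => -> /eqP.
  by rewrite eqNr oner_eq0.
have S2 i b : P (eps i @^-1` S b) = (2^-1)%:E.
  by have [h1 h2] := eps2 i; case: b; rewrite /S ?expr0 ?expr1.
rewrite (integral_sign_events eps_indep mS SD S2 mW W0) mulr_sumr -sumEFin.
apply: lee_sum => e _; rewrite mulrC EFinM.
have mD := measurable_sign_event eps mS [set: I] e.
have PD := sign_event_prob eps_indep mS S2 [set: I] e.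
rewrite cardsT in PD; rewrite -PD -integral_cst//.
have bF' : is_bounded (fun t => `|\sum_i (-1) ^+ e i * F i t|).
  by apply/is_bounded_norm/is_bounded_sum => i; exact: is_boundedZ.
have sup0 : 0 <= supr (fun t => `|\sum_i (-1) ^+ e i * F i t|).
  exact: le_trans (supr_ub t0 bF').
apply: ge0_le_integral => //.
- exact: measurable_funTS.
- move=> w we; apply: le_trans (Wle w) _; rewrite lee_fin.
  rewrite le_eqVlt; apply/orP; left; apply/eqP; congr supr; apply/funext => t.
  congr `|_|; apply: eq_bigr => i _; congr (_ * _).
  by have := we i; rewrite /= !inE => /(_ isT).
Qed.

(** On each sign event, [Z] is bounded below by the linear form at a fixed [t]; the form is
    integrated first and the supremum over [t] is taken afterwards. *)
Lemma gauss_average_ge (g : I -> {RV P >-> R}) (v : I -> T -> R)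
    (Z : Omega -> \bar R) :
  (0 < #|I|)%N ->
  independent_family P g ->
  (forall i A, measurable A -> distribution P (g i) A = normal_prob 0 1 A) ->
  (forall i, is_bounded (v i)) ->
  measurable_fun setT Z -> (forall w, (0 <= Z w)%E) ->
  (forall w t, ((\sum_i v i t * g i w)%:E <= Z w)%E) ->
  ((2 * normal_peak 1 * (2 ^- #|I| * \sum_(e : {ffun I -> bool})
     supr (fun t => \sum_i (-1) ^+ e i * v i t)))%:E <= \int[P]_w Z w)%E.
Proof.
move=> I0 g_indep gN bv mZ Z0 Zge.
have mS b := @measurable_halfline R b.
have SD x : @halfline R true x -> @halfline R false x -> False.
  rewrite /halfline/= mulN1r mul1r oppr_gt0 => /lt_trans /[apply].
  by rewrite ltxx.
have S2 i b : P (g i @^-1` halfline b) = (2^-1)%:E.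
  by rewrite -(normal_prob_halfline b) -(gN i).
rewrite (integral_sign_events g_indep mS SD S2 mZ Z0) mulrA mulr_sumr -sumEFin.
apply: lee_sum => e _.
set D := sign_event _ _ _ _.
have mD : measurable D by exact: measurable_sign_event.
(* The pattern of the other indices has mass 2^-(|I|-1) and is independent of [g a], and |x| has
   integral [normal_peak 1] over a half-line. *)
have intg a : (\int[P]_(w in D) `|g a w|%:E =
    (2 * normal_peak 1 * 2 ^- #|I| : R)%:E)%E.
  pose B := sign_event g (@halfline R) [set~ a] e.
  have mB : measurable B by exact: measurable_sign_event.
  have DB : D = B `&` g a @^-1` halfline (e a).
    apply/seteqP; split => [w wD|w [wB wa] i _].
      by split=> [i _|]; apply: wD; rewrite /= inE.
    have [->//|ia] := eqVneq i a.
    by apply: wB; rewrite /= !inE.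
  have mg : measurable_fun setT (g a) by exact: measurable_funPT.
  have IE := @integral_indep_event _ _ _ P _ (measurableTypeR R) B (g a)
    (normal_prob 0 1) (halfline (e a)) (fun x : R => `|x|%:E) mg mB.
  rewrite DB IE//; first last.
  - move=> /= A mA; transitivity (P B * P (g a @^-1` A))%E; last first.
      by congr (_ * _)%E; exact: gN.
    (* The product formula is used with [A] at the index [a] and half-lines elsewhere. *)
    pose H i : set R := if i == a then A else halfline (e i).
    have mH i : measurable (H i : set R).
      by rewrite /H; case: ifP => _; [exact: mA|exact: mS].
    have := g_indep [set: I]%SET H (fun i _ => mH i).
    rewrite (bigD1 a)//= {2}/H eqxx => h.
    transitivity (P (\bigcap_(i in [set` [set: I]%SET]) g i @^-1` H i)).
      congr (P _); apply/seteqP; split => [w [wB wa] i _|w wH].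
        rewrite /H /=; case: eqVneq => [->//|ia]; apply: wB.
        by rewrite /= !inE.
      split => [i /=|].
        rewrite !inE => ia; have := wH i; rewrite /H/= (negbTE ia).
        by apply; rewrite inE.
      by have := wH a; rewrite /H /= eqxx; apply; rewrite inE.
    rewrite h muleC; congr (_ * _)%E.
    rewrite /B /sign_event g_indep//.
    apply: eq_big => i; first by rewrite !inE.
    by rewrite /H !inE/= => /negbTE ->.
  - by apply/measurable_EFinP; apply: measurable_funTS; exact: normr_measurable.
  - exact: measurable_halfline.
  rewrite sign_event_prob// normal_prob_abs_halfline -EFinM; congr EFin.
  rewrite cardsC1 -[in RHS](prednK I0) exprS invfM mulrC mulrACA.
  by rewrite divff ?mul1r// pnatr_eq0.
set K : R := 2 * normal_peak 1 / 2 ^+ #|I|.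
have K0 : 0 <= K by rewrite divr_ge0// mulr_ge0// normal_peak_ge0.
rewrite -(suprZ t0)//; last first.
  by apply: is_bounded_sum => i; exact: is_boundedZ.
apply: (EFin_supr_le t0) => t.
(* An infinite integral bounds everything; otherwise [Z] is integrable and can be compared with a
   function of variable sign. *)
have [Zoo|Zoo] := leP +oo%E (\int[P]_(w in D) Z w)%E.
  exact: le_trans (leey _) Zoo.
have iZ : P.-integrable D Z.
  apply/integrableP; split; first exact: measurable_funTS.
  by under eq_integral do rewrite gee0_abs//.
have iga a : P.-integrable D (fun w => `|g a w|%:E)%E.
  apply/integrableP; split.
    apply/measurable_EFinP; apply: measurable_funTS.
    by apply: measurableT_comp; [exact: normr_measurable|exact: measurable_funPT].
  under eq_integral do rewrite gee0_abs//.
  by rewrite intg ltry.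
have ig a : P.-integrable D (fun w => ((-1) ^+ e a * v a t)%:E * `|g a w|%:E)%E.
  exact: integrableZl.
have <- : (\int[P]_(w in D) \sum_a (((-1) ^+ e a * v a t)%:E * `|g a w|%:E) =
    (K * \sum_i (-1) ^+ e i * v i t)%:E)%E.
  rewrite integral_sum// mulr_sumr -sumEFin; apply: eq_bigr => a _.
  by rewrite integralZl// intg -EFinM mulrC.
apply: le_integral => //; first by apply: integrable_sum => // a _; exact: ig.
move=> w /set_mem wD; apply: le_trans (Zge w t).
under eq_bigr do rewrite -EFinM.
rewrite sumEFin lee_fin; apply: ler_sum => a _.
(* On this event [g a w] has the sign [(-1) ^+ e a], hence equals this sign times its absolute
   value. *)
have : halfline (e a) (g a w) by apply: wD; rewrite /= inE.
rewrite /halfline/= -mulrA mulrCA => ga; rewrite le_eqVlt; apply/orP; left.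
apply/eqP; congr (_ * _).
by rewrite -[in RHS](signrMK (e a) (g a w)) -(gtr0_norm ga) normrMsign.
Qed.
End rademacher_gauss.

Section symmetrization.
Context d (Omega : measurableType d) (R : realType) (P : probability Omega R).
Context {T : Type} (t0 : T) (n r : nat).

(** The factor 2 lost to the absolute value cancels against the one in [2 * normal_peak 1], the mean
    of |xi|. *)
Lemma rademacher_le_gauss (eps : 'I_n -> {RV P >-> R})
    (xi : 'I_n -> 'I_r -> {RV P >-> R})
    (F : 'I_n -> T -> R) (v : 'I_n -> 'I_r -> T -> R) (W Z : Omega -> \bar R) :
  (0 < n)%N -> (0 < r)%N -> independent_family P eps ->
  (forall i, P (eps i @^-1` [set 1]) = (2^-1)%:E /\
             P (eps i @^-1` [set -1]) = (2^-1)%:E) ->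
  independent_family P (fun ik : 'I_n * 'I_r => xi ik.1 ik.2) ->
  (forall i k (A : set R), measurable A ->
     distribution P (xi i k) A = normal_prob 0 1 A) ->
  (forall i, is_bounded (F i)) -> (forall i k, is_bounded (v i k)) ->
  (forall i, F i t0 = 0) ->
  (forall i s t, `|F i s - F i t| <= \sum_k `|v i k s - v i k t|) ->
  measurable_fun setT W -> (forall w, (0 <= W w)%E) ->
  (forall w, (W w <= (supr (fun t => `|\sum_i eps i w * F i t|))%:E)%E) ->
  measurable_fun setT Z -> (forall w, (0 <= Z w)%E) ->
  (forall w t, ((\sum_i \sum_k v i k t * xi i k w)%:E <= Z w)%E) ->
  (\int[P]_w W w <=
   ((normal_peak 1)^-1 * 2 ^+ (r - 1))%:E * \int[P]_w Z w)%E.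
Proof.
move=> n0 r0 eps_indep eps2 xi_indep xiN bF bv F0 lip mW W0 Wle mZ Z0 Zge.
have card_gt0 : (0 < #|{: 'I_n * 'I_r}|)%N.
  by rewrite card_prod !card_ord muln_gt0 n0.
have peak0 : 0 < normal_peak 1 :> R by apply: normal_peak_gt0; exact: oner_neq0.
apply: le_trans (rademacher_average_le t0 eps_indep eps2 bF mW W0 Wle) _.
rewrite card_ord.
apply: (@le_trans _ _ (2 ^+ (r - 1) * (2 * (2 ^- (n * r) *
  \sum_(e : {ffun 'I_n * 'I_r -> bool})
    supr (fun t => \sum_ik (-1) ^+ e ik * v ik.1 ik.2 t))))%:E).
  by rewrite lee_fin; exact: vector_contraction_norm.
have /= := gauss_average_ge (v := fun ik => v ik.1 ik.2) t0 card_gt0 xi_indep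
  (fun ik => xiN ik.1 ik.2) (fun ik => bv ik.1 ik.2) mZ Z0.
rewrite card_prod !card_ord; set S := _ * \sum_e _ => h.
have {}h : ((2 * normal_peak 1 * S)%:E <= \int[P]_w Z w)%E.
  apply: h => w t; apply: le_trans (Zge w t).
  by rewrite pair_big.
apply: le_trans (lee_wpmul2l _ h); last first.
  by rewrite lee_fin mulr_ge0 ?exprn_ge0// invr_ge0 ltW.
rewrite -EFinM lee_fin le_eqVlt; apply/orP; left; apply/eqP.
by field; rewrite gt_eqF.
Qed.

End symmetrization.

(** * Conditional expectation of functions of independent data *)

Section indep_fubini.
Context d (Omega : measurableType d) (R : realType) (P : probability Omega R).
Context d1 (T1 : measurableType d1) d2 (T2 : measurableType d2).
Variables (U : {mfun Omega >-> T1}) (V : {mfun Omega >-> T2}).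
Variable Phi : T1 * T2 -> \bar R.
Hypothesis mPhi : measurable_fun setT Phi.
Hypothesis Phi0 : forall x, (0 <= Phi x)%E.
Local Open Scope ereal_scope.

Lemma measurable_integral_section :
  measurable_fun setT (fun u => \int[P]_w Phi (u, V w)).
Proof.
rewrite (_ : (fun _ => _) = fubini_F (distribution P V) Phi).
  exact: measurable_fun_fubini_tonelli_F.
apply/funext => u; rewrite /fubini_F ge0_integral_distribution//.
exact: measurableT_comp.
Qed.

(** Independence makes the law of the pair the product of the two laws; the rest is Tonelli's
    theorem. *)
Lemma indep_fubini :
  (forall A B, measurable A -> measurable B ->
    P (U @^-1` A `&` V @^-1` B) = P (U @^-1` A) * P (V @^-1` B)) ->
  \int[P]_w Phi (U w, V w) = \int[P]_w \int[P]_w' Phi (U w, V w').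
Proof.
move=> UV.
have mUV : measurable_fun setT (fun w => (U w, V w)).
  by apply: measurable_fun_pair; exact: measurable_funPT.
pose UVf : {mfun Omega >-> (T1 * T2)%type} :=
  HB.pack (fun w => (U w, V w)) (isMeasurableFun.Build _ _ _ _ _ mUV).
transitivity (\int[distribution P UVf]_z Phi z).
  by rewrite ge0_integral_distribution.
transitivity (\int[(distribution P U \x distribution P V)%E]_z Phi z).
  apply: eq_measure_integral => A mA _; apply/esym.
  exact: product_measure_unique.
rewrite fubini_tonelli1//.
rewrite ge0_integral_distribution//; last 2 first.
- exact: measurable_fun_fubini_tonelli_F.
- by move=> x; exact: integral_ge0.
apply: eq_integral => w _ /=; rewrite /fubini_F ge0_integral_distribution//.
exact: measurableT_comp.
Qed.

End indep_fubini.

Section conditional_expectation.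
Context d (Omega : measurableType d) (R : realType) (P : probability Omega R).
Local Open Scope ereal_scope.

Lemma sub_g_sigma_algebra (G : set_system Omega) : G `<=` measurable ->
  <<s G >> `<=` measurable.
Proof.
by move=> Gm; apply: smallest_sub => //; exact: sigma_algebra_measurable.
Qed.

(* [idfun] is measurable from [Omega] to [Omega] with the smaller sigma-algebras,
   and the two copies of it are independent. *)
Lemma cond_expectation_indep (G H : set_system Omega)
    (Phi : g_sigma_algebraType G * g_sigma_algebraType H -> \bar R) :
  G `<=` measurable -> H `<=` measurable ->
  independent_systems P <<s H >> <<s G >> ->
  measurable_fun setT Phi -> (forall x, 0 <= Phi x) ->
  is_cond_expectation P <<s G >> (fun w => Phi (w, w))
    (fun w => \int[P]_w' Phi (w, w')).
Proof.
move=> Gm Hm HG mPhi Phi0.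
have mU : measurable_fun setT (idfun : Omega -> g_sigma_algebraType G).
  by move=> _ A mA; rewrite setTI; exact: sub_g_sigma_algebra Gm _ mA.
have mV : measurable_fun setT (idfun : Omega -> g_sigma_algebraType H).
  by move=> _ A mA; rewrite setTI; exact: sub_g_sigma_algebra Hm _ mA.
pose U : {mfun Omega >-> g_sigma_algebraType G} :=
  HB.pack (idfun : Omega -> g_sigma_algebraType G)
   (isMeasurableFun.Build _ _ _ _ _ mU).
pose V : {mfun Omega >-> g_sigma_algebraType H} :=
  HB.pack (idfun : Omega -> g_sigma_algebraType H)
   (isMeasurableFun.Build _ _ _ _ _ mV).
have UV A B : measurable A -> measurable B ->
    P (U @^-1` A `&` V @^-1` B) = P (U @^-1` A) * P (V @^-1` B).
  by move=> mA mB; rewrite setIC muleC; exact: HG.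
have mE := measurable_integral_section P V mPhi Phi0.
split.
- split=> [|w]; last exact: Phi0.
  apply: (measurableT_comp mPhi); apply: measurable_fun_pair.
    exact: mU.
  exact: mV.
- by move=> w; exact: integral_ge0.
- by move=> B mB; have := mE measurableT _ mB; rewrite setTI.
- move=> A FA.
  (* The event [A] depends on the first coordinate only, so its indicator is absorbed into the
     integrand as [Psi]. *)
  pose A1 : set (g_sigma_algebraType G) := A.
  pose Psi : g_sigma_algebraType G * g_sigma_algebraType H -> \bar R :=
    Phi \_ (A1 `*` setT).
  have mPsi : measurable_fun setT Psi.
    have mA1 : measurable (A1 `*` [set: g_sigma_algebraType H]).
      exact: measurableX.
    exact: (measurable_restrictT Phi mA1).1 (measurable_funTS mPhi).
  have Psi0 x : 0 <= Psi x by rewrite /Psi patchE; case: ifP.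
  rewrite [LHS]integral_mkcond [RHS]integral_mkcond.
  have := indep_fubini mPsi Psi0 UV.
  rewrite [X in X = _ -> _](_ : _ = \int[P]_w ((fun w => Phi (w, w)) \_ A) w).
    move=> ->; apply: eq_integral => w _; rewrite patchE; case: ifPn => wA.
      apply: eq_integral => w' _; rewrite /Psi patchE ifT//.
      by rewrite inE; split => //; exact/set_mem.
    rewrite integral0_eq// => w' _; rewrite /Psi patchE ifF//.
    by apply/negbTE; move: wA; apply: contra; rewrite !inE => -[].
  apply: eq_integral => w _; rewrite /Psi !patchE.
  have -> : ((w, w) \in A1 `*` setT) = (w \in A).
    by apply/idP/idP; rewrite !inE => // -[].
  by [].
Qed.

(* Ef and c Eg are compared on the events {c Eg <= q1 < q2 <= Ef} for rational
   q1 < q2, on which c Eg is bounded: Ef and Eg need not be integrable. *)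
Lemma cond_expectation_le (G : set_system Omega) (f g Ef Eg : Omega -> \bar R)
    (c : R) : G `<=` measurable -> (0 <= c)%R ->
  is_cond_expectation P <<s G >> f Ef -> is_cond_expectation P <<s G >> g Eg ->
  (forall A, <<s G >> A ->
    \int[P]_(w in A) f w <= c%:E * \int[P]_(w in A) g w) ->
  {ae P, forall w, Ef w <= c%:E * Eg w}.
Proof.
move=> Gm c0 [_ Ef0 mEf EfE] [_ Eg0 mEg EgE] fg.
have Fm := sub_g_sigma_algebra Gm.
pose T1 := g_sigma_algebraType G.
have mEf1 : measurable_fun setT (Ef : T1 -> \bar R).
  by move=> _ B mB; rewrite setTI; exact: mEf.
have mEg1 : measurable_fun setT (Eg : T1 -> \bar R).
  by move=> _ B mB; rewrite setTI; exact: mEg.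
have mEf2 : measurable_fun setT Ef.
  by move=> _ B mB; rewrite setTI; apply: Fm; exact: mEf.
have mEg2 : measurable_fun setT Eg.
  by move=> _ B mB; rewrite setTI; apply: Fm; exact: mEg.
have mcEg1 : measurable_fun setT (fun w : T1 => c%:E * Eg w).
  exact: measurable_funeM.
have mcEg2 : measurable_fun setT (fun w => c%:E * Eg w).
  exact: measurable_funeM.
pose A (q : rat * rat) := [set w | c%:E * Eg w <= (ratr q.1)%:E] `&`
   [set w | (ratr q.2)%:E <= Ef w].
have FA q : <<s G >> (A q).
  have : (@measurable _ T1) (setT `&` [set w | c%:E * Eg w <= (ratr q.1)%:E] `&`
     (setT `&` [set w | (ratr q.2)%:E <= Ef w])).
    apply: measurableI.
      exact: (measurable_lee measurableT mcEg1 (measurable_cst _)).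
    exact: (measurable_lee measurableT (measurable_cst _) mEf1).
  by rewrite !setTI.
have cEg0 w : 0 <= c%:E * Eg w by rewrite mule_ge0 ?lee_fin.
have PA (q : rat * rat) : (q.1 < q.2)%R -> P (A q) = 0.
  move=> q12; have mA := Fm _ (FA q).
  have [q10|q10] := ltP (ratr q.1 : R) 0%R.
    rewrite (_ : A q = set0) ?measure0//; apply/seteqP; split => // w [/= + _].
    by move=> /(le_trans (cEg0 w)); rewrite lee_fin leNgt q10.
  have q20 : (0 <= ratr q.2 :> R)%R.
    by apply: le_trans q10 _; rewrite ler_rat ltW.
  have [x xE] : exists x, P (A q) = x%:E.
    by exists (fine (P (A q))); rewrite fineK// fin_num_measure.
  (* On [A q], integrating gives q2 P <= int Ef = int f <= c int g = c int Eg <= q1 P, which forces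
     P = 0 since q1 < q2. *)
  have : (ratr q.2)%:E * P (A q) <= (ratr q.1)%:E * P (A q).
    rewrite -!integral_cst//.
    apply: (@le_trans _ _ (\int[P]_(w in A q) Ef w)).
      apply: ge0_le_integral => //; first exact: measurable_funTS.
      by move=> w [].
    rewrite EfE//; apply: (le_trans (fg _ (FA q))); rewrite -EgE//.
    rewrite -ge0_integralZl//; last exact: measurable_funTS.
    apply: ge0_le_integral => //; first exact: measurable_funTS.
    by move=> w [].
  rewrite xE -!EFinM lee_fin => h.
  have x0 : (0 <= x)%R by rewrite -lee_fin -xE.
  have q12R : (ratr q.1 < ratr q.2 :> R)%R by rewrite ltr_rat.
  move: h; rewrite -subr_le0 -mulrBl pmulr_rle0 ?subr_gt0// => x0'.
  by congr EFin; apply: le_anti; rewrite x0 x0'.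
(* The countably many null events are enumerated by codes of pairs of rationals; all other codes
   give the empty set. *)
pose N n := if (unpickle n : option (rat * rat)) is Some q then
   (if (q.1 < q.2)%R then A q else set0) else set0.
apply: (@negligibleS _ _ _ _ (\bigcup_n N n)); last first.
  apply: negligible_bigcup => n; rewrite /N.
  case: unpickle => [q|]; last exact: negligible_set0.
  case: ifPn => q12; last exact: negligible_set0.
  by apply/negligibleP; [apply: Fm; exact: FA|exact: PA].
move=> w /= /negP; rewrite -ltNge => lt.
suff [q [q12 Aq]] : exists q : rat * rat, (q.1 < q.2)%R /\ A q w.
  exists (pickle q); first exact: I.
  rewrite /N pickleK q12; exact: Aq.
have Egfin : c%:E * Eg w \is a fin_num.
  by rewrite ge0_fin_numE//; exact: lt_le_trans lt (leey _).
have [x Egx] : exists x, c%:E * Eg w = x%:E.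
  by exists (fine (c%:E * Eg w)); rewrite fineK.
(* [Ef w] may be infinite, in which case x + 1 serves as the real bound. *)
have [y [xy yEf]] : exists y : R, (x < y)%R /\ y%:E <= Ef w.
  move: lt; rewrite Egx; case: (Ef w) => [y|_|]//.
    by rewrite lte_fin; exists y.
  by exists (x + 1)%R; rewrite ltrDl ltr01 leey.
have [q2 /[!in_itv]/= /andP[xq2 q2y]] := rat_in_itvoo xy.
have [q1 /[!in_itv]/= /andP[xq1 q1q2]] := rat_in_itvoo xq2.
exists (q1, q2); split; first by rewrite -(ltr_rat R).
split => /=; first by rewrite Egx lee_fin ltW.
by apply: le_trans yEf; rewrite lee_fin ltW.
Qed.

(** All versions have the same integrals over events of the sigma-algebra, so a pointwise comparison
    of one pair of versions passes to every pair. *)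
Lemma le_cond_expectation (G : set_system Omega)
    (f g Ef Eg Ef' Eg' : Omega -> \bar R) (c : R) :
  G `<=` measurable -> (0 <= c)%R ->
  is_cond_expectation P <<s G >> f Ef -> is_cond_expectation P <<s G >> g Eg ->
  is_cond_expectation P <<s G >> f Ef' -> is_cond_expectation P <<s G >> g Eg' ->
  (forall w, Ef w <= c%:E * Eg w) ->
  {ae P, forall w, Ef' w <= c%:E * Eg' w}.
Proof.
move=> Gm c0 cEf cEg cEf' cEg' le; apply: (cond_expectation_le Gm c0 cEf' cEg').
move=> A FA; have [_ Ef0 mEf EfE] := cEf; have [_ Eg0 mEg EgE] := cEg.
have mA := sub_g_sigma_algebra Gm FA.
have mE (h : Omega -> \bar R) : (forall B, measurable B -> <<s G >> (h @^-1` B)) ->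
    measurable_fun A h.
  move=> mh; apply: measurable_funTS => _ B mB; rewrite setTI.
  by apply: (sub_g_sigma_algebra Gm); exact: mh.
rewrite -EfE// -EgE// -ge0_integralZl//; last exact: mE.
apply: ge0_le_integral => //; first exact: mE.
by apply: measurable_funeM; exact: mE.
Qed.

End conditional_expectation.

(** * Suprema of Lipschitz families *)

Section countable_sup.
Context {R : realType} {m : nat}.
Implicit Types (A : set 'rV[R]_m) (a b : 'rV[R]_m).

Lemma l1norm_ge0 a : 0 <= l1norm a.
Proof. exact: sumr_ge0. Qed.

Lemma l1normD a b : l1norm (a + b) <= l1norm a + l1norm b.
Proof.
rewrite /l1norm -big_split/=; apply: ler_sum => l _.
by rewrite mxE ler_normD.
Qed.

Lemma l1normN a : l1norm (- a) = l1norm a.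
Proof. by apply: eq_bigr => l _; rewrite mxE normrN. Qed.

Lemma l1norm_rat_approx a (e : R) : 0 < e ->
  exists q : 'rV[rat]_m, l1norm (a - map_mx ratr q) < e.
Proof.
move=> e0; pose e' := e / m.+1%:R.
have e'0 : 0 < e' by rewrite divr_gt0.
have /choice[q hq] (l : 'I_m) : exists x : rat, `|a 0 l - ratr x| < e'.
  have [|x] := @rat_in_itvoo R (a 0 l - e') (a 0 l + e'); first by lra.
  by rewrite in_itv/= => hx; exists x; rewrite ltr_distl; lra.
exists (\row_l q l).
apply: (@le_lt_trans _ _ (\sum_(l < m) e')).
  by apply: ler_sum => l _; rewrite !mxE ltW.
rewrite sumr_const card_ord /e' -mulrnAl -mulr_natr -mulrA.
by rewrite gtr_pMr// ltr_pdivrMr// mul1r ltr_nat.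
Qed.

Lemma exists_dense_seq A a0 : A a0 -> exists2 f : nat -> 'rV[R]_m,
  (forall n, A (f n)) &
  (forall a (e : R), A a -> 0 < e -> exists n, l1norm (a - f n) < e).
Proof.
move=> Aa0.
pose cell (q : 'rV[rat]_m) (k : nat) :=
  A `&` [set a | l1norm (a - map_mx ratr q) < k.+1%:R^-1].
pose f n := if unpickle n is Some (q, k) then
  (if pselect (cell q k !=set0) then xget a0 (cell q k) else a0) else a0.
have Af n : A (f n).
  rewrite /f; case: unpickle => // -[q k]; case: pselect => // -[a ha].
  by have [] := xgetPex a0 (ex_intro _ a ha).
exists f => // a e Aa e0.
have [k ke] : exists k, k.+1%:R^-1 < e / 2.
  have e20 : 0 < e / 2 by rewrite divr_gt0.
  by have [k] := ltr_add_invr e20; rewrite add0r; exists k.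
have [|q aq] := @l1norm_rat_approx a k.+1%:R^-1; first by rewrite invr_gt0.
exists (pickle (q, k)); rewrite /f pickleK.
case: pselect => [h|[]]; last by exists a.
have [_ /= fq] := xgetPex a0 h.
rewrite -(subrKA (map_mx ratr q)) addrC.
apply: le_lt_trans (l1normD _ _) _.
rewrite -(l1normN (map_mx ratr q - _)) opprB [e]splitr.
by apply: ltrD; [exact: lt_trans fq ke|exact: lt_trans aq ke].
Qed.

Lemma ereal_sup_dense_seq A (f : nat -> 'rV[R]_m) (Z : 'rV[R]_m -> R) (K : R) :
  (forall n, A (f n)) ->
  (forall a (e : R), A a -> 0 < e -> exists n, l1norm (a - f n) < e) ->
  (forall a b, A a -> A b -> `|Z a - Z b| <= K * l1norm (a - b)) ->
  ereal_sup [set (Z a)%:E | a in A] = ereal_sup (range (fun n => (Z (f n))%:E)).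
Proof.
move=> Af dense lip; apply/eqP; rewrite eq_le; apply/andP; split.
  apply: ge_ereal_sup => _ [a Aa <-]; apply/lee_addgt0Pr => e e0.
  pose K' := `|K| + 1.
  have K'0 : 0 < K' by rewrite ltr_wpDl.
  have [|n an] := dense a (e / K') Aa; first by rewrite divr_gt0.
  apply: (@le_trans _ _ ((Z (f n))%:E + e%:E)%E); last first.
    by rewrite leeD2r//; apply: ereal_sup_ubound; exists n.
  rewrite lee_fin -lerBlDl; apply: le_trans (ler_norm _) _.
  apply: (le_trans (lip _ _ Aa (Af n))).
  apply: (@le_trans _ _ (K' * l1norm (a - f n))).
    rewrite ler_wpM2r ?l1norm_ge0// (le_trans (ler_norm _))// lerDl//.
  by rewrite -ler_pdivlMl// mulrC ltW.
by apply: ge_ereal_sup => _ [n _ <-]; apply: ereal_sup_ubound; exists (f n).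
Qed.

End countable_sup.

Lemma measurable_ereal_sup_lipschitz {R : realType} {m : nat} d
    (T : measurableType d) (A : set 'rV[R]_m) (a0 : 'rV[R]_m)
    (Z : 'rV[R]_m -> T -> R) (K : T -> R) :
  A a0 -> (forall a, A a -> measurable_fun setT (Z a)) ->
  (forall a b x, A a -> A b -> `|Z a x - Z b x| <= K x * l1norm (a - b)) ->
  measurable_fun setT (fun x => ereal_sup [set (Z a x)%:E | a in A]).
Proof.
move=> Aa0 mZ lip; have [f Af dense] := exists_dense_seq Aa0.
rewrite (_ : (fun _ => _) = (fun x => esups (fun n => (Z (f n) x)%:E) 0%N)).
  by apply: measurable_fun_esups => n; apply/measurable_EFinP; exact: mZ.
apply/funext => x.
rewrite (ereal_sup_dense_seq (K := K x) Af dense (Z := Z ^~ x)); last first.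
  by move=> a b; exact: lip.
rewrite /esups /sdrop; congr ereal_sup.
by apply/seteqP; split => _ [n _ <-]; exists n.
Qed.

(** * The comparison theorem *)

Section sigma_family.
Context (I : Type) d d' (T : measurableType d) (S : measurableType d').
Variable f : I -> {mfun T >-> S}.

Definition family_preimages : set_system T :=
  \bigcup_(i in [set: I]) preimage_set_system setT (f i) measurable.

Lemma family_preimages_measurable : family_preimages `<=` measurable.
Proof.
move=> _ [i _ [B mB <-]]; rewrite setTI.
by apply: measurable_preimage => //; exact: measurable_funPT.
Qed.

Lemma measurable_sigma_family i :
  measurable_fun setT (f i : g_sigma_algebraType family_preimages -> S).
Proof. by move=> _ B mB; apply: sub_gen_smallest; exists i => //; exists B. Qed.

End sigma_family.

Section lipschitz_bounds.
Context {R : realType} {n r : nat} {p : 'I_r -> nat}.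
Local Notation vec := 'rV[R]_(\sum_(k < r) p k)%N.
Implicit Types theta : vec.

Lemma entryB_le_l1norm theta theta' k (j : 'I_(p k)) :
  `|entry theta j - entry theta' j| <= l1norm (theta - theta').
Proof.
rewrite /l1norm (bigD1 (tagnat.Rank k j))//= !mxE lerDl.
exact: sumr_ge0.
Qed.

Lemma sum_entryB_le theta theta' (a : forall k : 'I_r, 'I_(p k) -> R) :
  \sum_(k < r) `|\sum_(j < p k) (entry theta j - entry theta' j) * a k j| <=
  (\sum_(k < r) \sum_(j < p k) `|a k j|) * l1norm (theta - theta').
Proof.
rewrite mulr_suml; apply: ler_sum => k _.
apply: le_trans (ler_norm_sum _ _ _) _.
rewrite mulr_suml; apply: ler_sum => j _.
by rewrite normrM mulrC ler_wpM2l// entryB_le_l1norm.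
Qed.

End lipschitz_bounds.

Theorem theorem4p1 (R : realType) :
  exists C : R,
  forall (d d' : measure_display) (Omega : measurableType d)
    (P : probability Omega R) (X : measurableType d')
    (n r : nat) (p : 'I_r -> nat) (n_gt0 : (0 < n)%N) (r_gt0 : (0 < r)%N)
    (Xs : 'I_n -> {RV P >-> X}) (Xs_indep : independent_family P Xs)
    (Theta Thetas : set 'rV[R]_(\sum_(k < r) p k)%N)
    (ThetasE : Thetas = Theta \/
               Thetas = smallest (@convex_set R 'rV[R]_(\sum_(k < r) p k)%N) Theta)
    (rho : 'rV[R]_(\sum_(k < r) p k)%N -> X -> R)
    (rho_meas : forall theta, Thetas theta -> measurable_fun setT (rho theta))
    (thetastar : 'rV[R]_(\sum_(k < r) p k)%N) (thetastar_in : Theta thetastar)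
    (M : R) (M_gt0 : 0 < M)
    (eps : 'I_n -> {RV P >-> R})
    (eps_indep : independent_family P eps)
    (eps_rademacher : forall i,
       P (eps i @^-1` [set 1]) = (2^-1)%:E /\
       P (eps i @^-1` [set -1]) = (2^-1)%:E)
    (eps_indep_Xs : independent_systems P (sigma_family eps) (sigma_family Xs))
    (psi : forall k : 'I_r, 'I_(p k) -> X -> 'I_n -> R)
    (psi_ge0 : forall k j x i, 0 <= psi k j x i)
    (psi_meas : forall k j i, measurable_fun setT (fun x => psi k j x i))
    (c : 'I_n -> 'rV[R]_(\sum_(k < r) p k)%N -> R)
    (lipschitz : forall theta theta', Thetas theta -> Thetas theta' ->
       forall (i : 'I_n) (w : Omega),
       `|rho_c rho c theta (Xs i w) i - rho_c rho c theta' (Xs i w) i| <=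
       \sum_(k < r) `|\sum_(j < p k)
          (entry theta j - entry theta' j) * psi k j (Xs i w) i|)
    (xi : 'I_n -> 'I_r -> {RV P >-> R})
    (xi_indep : independent_family P (fun ik : 'I_n * 'I_r => xi ik.1 ik.2))
    (xi_normal : forall i k (A : set R), measurable A ->
       distribution P (xi i k) A = normal_prob 0 1 A)
    (xi_indep_Xs : independent_systems P
       (sigma_family (fun ik : 'I_n * 'I_r => xi ik.1 ik.2)) (sigma_family Xs)),
  let supY := sup_over (l1ball_in Thetas thetastar M)
    (fun theta w => `|Y_eps rho c Xs eps theta thetastar w|) in
  let supX := sup_over (l1ball_in Thetas thetastar M)
    (fun theta w => X_gauss psi Xs xi theta thetastar w) in
  [/\ exists EY, is_cond_expectation P (sigma_family Xs) supY EY,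
      exists EX, is_cond_expectation P (sigma_family Xs) supX EX &
      forall EY EX,
        is_cond_expectation P (sigma_family Xs) supY EY ->
        is_cond_expectation P (sigma_family Xs) supX EX ->
        {ae P, forall w, (EY w <= (C * 2 ^+ (r - 1))%:E * EX w)%E}].
Proof.
exists (normal_peak 1)^-1 => d d' Omega P X n r p n_gt0 r_gt0 Xs _ Theta Thetas
  ThetasE rho rho_meas thetastar thetastar_in M M_gt0 eps eps_indep eps2
  eps_indep_Xs psi psi_ge0 psi_meas c lipschitz xi xi_indep xi_normal
  xi_indep_Xs supY supX.
pose ball := l1ball_in Thetas thetastar M.
have star_in : ball thetastar.
  split; last by rewrite subrr /l1norm big1 ?ltW// => l _; rewrite mxE normr0.
  by case: ThetasE => ->//; exact: sub_gen_smallest.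
pose GX := family_preimages Xs.
pose Geps := family_preimages eps.
pose xi' (ik : 'I_n * 'I_r) := xi ik.1 ik.2.
pose Gxi := family_preimages xi'.
pose Yz theta (z : Omega * Omega) := `|n%:R^-1 * \sum_(i < n) eps i z.2 *
    (rho_c rho c theta (Xs i z.1) i - rho_c rho c thetastar (Xs i z.1) i)|.
pose Xz (theta : 'rV[R]_(\sum_(k < r) p k)) (z : Omega * Omega) :=
  n%:R^-1 * \sum_(i < n) \sum_(k < r) \sum_(j < p k)
    (entry theta j - entry thetastar j) * psi k j (Xs i z.1) i * xi i k z.2.
pose PhiY z : \bar R := ereal_sup [set (Yz theta z)%:E | theta in ball].
pose PhiX z : \bar R := ereal_sup [set (Xz theta z)%:E | theta in ball].
have subBB (x y z : R) : x - z - (y - z) = x - y by lra.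
have nV0 : 0 <= n%:R^-1 :> R by rewrite invr_ge0.
have mXs (i : 'I_n) : measurable_fun setT (Xs i : g_sigma_algebraType GX -> X).
  exact: (measurable_sigma_family (f := Xs)).
have meps (i : 'I_n) :
    measurable_fun setT (eps i : g_sigma_algebraType Geps -> R).
  exact: (measurable_sigma_family (f := eps)).
have mxi ik : measurable_fun setT (xi' ik : g_sigma_algebraType Gxi -> R).
  exact: (measurable_sigma_family (f := xi')).
have YzB theta theta' z : ball theta -> ball theta' ->
    `|Yz theta z - Yz theta' z| <= (n%:R^-1 * \sum_(i < n) `|eps i z.2| *
      \sum_(k < r) \sum_(j < p k) `|psi k j (Xs i z.1) i|) *
      l1norm (theta - theta').
  move=> [tin _] [tin' _]; apply: le_trans (ler_dist_dist _ _) _.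
  rewrite -mulrBr normrM ger0_norm// -mulrA ler_wpM2l// -sumrB mulr_suml.
  apply: le_trans (ler_norm_sum _ _ _) _; apply: ler_sum => i _.
  rewrite -mulrBr subBB normrM -mulrA ler_wpM2l//.
  exact: le_trans (lipschitz _ _ tin tin' i z.1) (sum_entryB_le _ _ _).
have XzB theta theta' z : ball theta -> ball theta' ->
    `|Xz theta z - Xz theta' z| <= (n%:R^-1 * \sum_(i < n)
      \sum_(k < r) \sum_(j < p k) `|psi k j (Xs i z.1) i * xi i k z.2|) *
      l1norm (theta - theta').
  move=> _ _.
  rewrite -mulrBr normrM ger0_norm// -mulrA ler_wpM2l// -sumrB mulr_suml.
  apply: le_trans (ler_norm_sum _ _ _) _; apply: ler_sum => i _.
  rewrite -sumrB; apply: le_trans (ler_norm_sum _ _ _) _.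
  apply: le_trans (sum_entryB_le _ _ _).
  apply: ler_sum => k _; rewrite -sumrB.
  rewrite le_eqVlt; apply/orP; left; apply/eqP; congr `|_|.
  apply: eq_bigr => j _; rewrite -!mulrA -mulrBl.
  by congr (_ * _); rewrite subBB.
have mPhiY : measurable_fun setT
    (PhiY : g_sigma_algebraType GX * g_sigma_algebraType Geps -> \bar R).
  apply: (measurable_ereal_sup_lipschitz
    (T := (g_sigma_algebraType GX * g_sigma_algebraType Geps)%type)
    (Z := Yz) star_in); last by move=> theta theta' z; exact: YzB.
  move=> theta [tin _].
  apply: measurableT_comp; first exact: normr_measurable.
  apply: measurable_funM; first exact: measurable_cst.
  apply: measurable_sum => i; apply: measurable_funM.
    exact: (measurableT_comp (meps i) measurable_snd).
  apply: measurable_funB; apply: measurable_funB => //.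
    exact: (measurableT_comp (rho_meas _ tin)
      (measurableT_comp (mXs i) measurable_fst)).
  exact: (measurableT_comp (rho_meas _ star_in.1)
    (measurableT_comp (mXs i) measurable_fst)).
have mPhiX : measurable_fun setT
    (PhiX : g_sigma_algebraType GX * g_sigma_algebraType Gxi -> \bar R).
  apply: (measurable_ereal_sup_lipschitz
    (T := (g_sigma_algebraType GX * g_sigma_algebraType Gxi)%type)
    (Z := Xz) star_in); last by move=> theta theta' z; exact: XzB.
  move=> theta _; apply: measurable_funM; first exact: measurable_cst.
  apply: measurable_sum => i; apply: measurable_sum => k.
  apply: measurable_sum => j; apply: measurable_funM.
    apply: measurable_funM; first exact: measurable_cst.
    exact: (measurableT_comp (psi_meas k j i)
      (measurableT_comp (mXs i) measurable_fst)).
  exact: (measurableT_comp (mxi (i, k)) measurable_snd).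
have PhiY0 z : (0 <= PhiY z)%E.
  apply: (@le_trans _ _ (Yz thetastar z)%:E); first by rewrite lee_fin /Yz.
  by apply: ereal_sup_ubound; exists thetastar.
have PhiX0 z : (0 <= PhiX z)%E.
  apply: (@le_trans _ _ (Xz thetastar z)%:E); last first.
    by apply: ereal_sup_ubound; exists thetastar.
  rewrite lee_fin /Xz big1 ?mulr0// => i _; rewrite big1// => k _.
  by rewrite big1// => j _; rewrite subrr !mul0r.
have GXm : GX `<=` measurable := family_preimages_measurable (f := Xs).
have Gepsm : Geps `<=` measurable := family_preimages_measurable (f := eps).
have Gxim : Gxi `<=` measurable := family_preimages_measurable (f := xi').
have cEY := cond_expectation_indep GXm Gepsm eps_indep_Xs mPhiY PhiY0.
have cEX := cond_expectation_indep GXm Gxim xi_indep_Xs mPhiX PhiX0.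
split; [by eexists; exact: cEY|by eexists; exact: cEX|move=> EY EX cEY' cEX'].
apply: (le_cond_expectation GXm _ cEY cEX cEY' cEX').
  by rewrite mulr_ge0 ?exprn_ge0// invr_ge0 normal_peak_ge0.
move=> w.
pose T := {theta | ball theta}.
pose t0 : T := exist _ thetastar star_in.
pose F (i : 'I_n) (t : T) := n%:R^-1 * (rho_c rho c (sval t) (Xs i w) i -
  rho_c rho c thetastar (Xs i w) i).
pose v (i : 'I_n) (k : 'I_r) (t : T) := n%:R^-1 *
  \sum_(j < p k) (entry (sval t) j - entry thetastar j) * psi k j (Xs i w) i.
have ballB (t : T) i :
    \sum_(k < r) `|\sum_(j < p k) (entry (sval t) j - entry thetastar j) *
      psi k j (Xs i w) i| <=
    (\sum_(k < r) \sum_(j < p k) `|psi k j (Xs i w) i|) * M.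
  apply: le_trans (sum_entryB_le _ _ _) _; rewrite ler_wpM2l ?(svalP t).2//.
  by apply: sumr_ge0 => k _; exact: sumr_ge0.
have sectionm (G H : set_system Omega)
    (Phi : g_sigma_algebraType G * g_sigma_algebraType H -> \bar R) :
    H `<=` measurable -> measurable_fun setT Phi ->
    measurable_fun setT (fun w' : Omega => Phi (w, w')).
  move=> Hm mPhi _ B mB; rewrite setTI; apply: (sub_g_sigma_algebra Hm).
  have mPhiw : measurable_fun setT
      (fun w' : g_sigma_algebraType H => Phi (w, w')).
    apply: (measurableT_comp mPhi).
    by apply: measurable_fun_pair; [exact: measurable_cst|exact: measurable_id].
  by have := mPhiw measurableT B mB; rewrite setTI.
have bF i : is_bounded (F i).
  exists (n%:R^-1 *
    ((\sum_(k < r) \sum_(j < p k) `|psi k j (Xs i w) i|) * M)) => t.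
  rewrite normrM ger0_norm// ler_wpM2l//; apply: le_trans (ballB t i).
  exact: lipschitz (svalP t).1 star_in.1 i w.
apply: (@rademacher_le_gauss _ _ _ P T t0 n r eps xi F v
  (fun w' => PhiY (w, w')) (fun w' => PhiX (w, w')) n_gt0 r_gt0 eps_indep eps2
  xi_indep xi_normal).
- exact: bF.
- move=> i k; exists (n%:R^-1 *
    ((\sum_(k < r) \sum_(j < p k) `|psi k j (Xs i w) i|) * M)) => t.
  rewrite normrM ger0_norm// ler_wpM2l//; apply: le_trans (ballB t i).
  by rewrite [leRHS](bigD1 k)//= lerDl sumr_ge0.
- by move=> i; rewrite /F subrr mulr0.
- move=> i s t; rewrite /F /v -mulrBr subBB normrM ger0_norm//.
  apply: (@le_trans _ _ (n%:R^-1 * \sum_(k < r) `|\sum_(j < p k)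
      (entry (sval s) j - entry (sval t) j) * psi k j (Xs i w) i|)).
    rewrite ler_wpM2l//.
    exact: lipschitz (svalP s).1 (svalP t).1 i w.
  rewrite mulr_sumr; apply: ler_sum => k _.
  rewrite -mulrBr normrM (ger0_norm nV0) ler_wpM2l// -sumrB.
  rewrite le_eqVlt; apply/orP; left; apply/eqP.
  by congr `|_|; apply: eq_bigr => j _; rewrite -mulrBl subBB.
- exact: sectionm Gepsm mPhiY.
- by move=> w'; exact: PhiY0.
- move=> w'; apply: ge_ereal_sup => _ [theta tin <-]; rewrite lee_fin.
  have bS : is_bounded (fun t => `|\sum_(i < n) eps i w' * F i t|).
    by apply/is_bounded_norm/is_bounded_sum => i; exact: is_boundedZ.
  apply: le_trans (supr_ub (exist _ theta tin) bS).
  rewrite /Yz mulr_sumr le_eqVlt; apply/orP; left; apply/eqP; congr `|_|.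
  by apply: eq_bigr => i _; rewrite mulrCA.
- exact: sectionm Gxim mPhiX.
- by move=> w'; exact: PhiX0.
- move=> w' [theta tin]; apply: ereal_sup_ubound; exists theta => //.
  congr EFin; rewrite /Xz /v mulr_sumr; apply: eq_bigr => i _.
  rewrite mulr_sumr; apply: eq_bigr => k _.
  by rewrite -mulrA mulr_suml.
Qed.
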